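(* Let $G$ be a finite simple $2$-connected graph and let $k \geq 3$ be an integer. If the degree of every vertex of $G$ is divisible by $k$, then every edge of $G$ is contained in a cycle of even length.
   Context: Graphs are finite, simple (no loops, no multiple edges). A graph is $2$-connected if it has more than $2$ vertices and remains connected whenever fewer than $2$ vertices are removed. The length of a cycle is its number of edges. *)

(* Defs.v *)
From mathcomp Require Import all_boot.

Set Implicit Arguments.
Unset Strict Implicit.
Unset Printing Implicit Defensive.

(* A finite simple graph is a finType T of vertices together with a symmetric
   irreflexive adjacency relation e : rel T. *)

Definition simple_graph (T : finType) (e : rel T) : Prop :=
  symmetric e /\ irreflexive e.

Definition degree (T : finType) (e : rel T) (x : T) : nat :=
  #|[set y | e x y]|.

Definition induced (T : finType) (e : rel T) (A : {set T}) : rel T :=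
  [rel x y | [&& x \in A, y \in A & e x y]].

(* The subgraph induced on A is connected; as usual, the graph with no vertex
   is not counted as connected. *)
Definition connected_on (T : finType) (e : rel T) (A : {set T}) : Prop :=
  A != set0 /\ {in A &, forall x y, connect (induced e A) x y}.

Definition k_connected (k : nat) (T : finType) (e : rel T) : Prop :=
  k < #|T| /\ forall S : {set T}, #|S| < k -> connected_on e (~: S).

(* A cycle is the cyclic sequence c of its (distinct) vertices. The size bound
   is needed: ucycleb also accepts [::] and, when e x y and e y x hold,
   [:: x; y]. A cycle has as many edges as vertices, so its length is size c. *)
Definition is_cycle (T : finType) (e : rel T) (c : seq T) : bool :=
  (2 < size c) && ucycleb e c.

(* The undirected edge xy joins two cyclically consecutive vertices of c. *)
Definition edge_in_cycle (T : finType) (x y : T) (c : seq T) : bool :=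
  [&& x \in c, y \in c & (next c x == y) || (next c y == x)].

(* Main.v *)
Require Import Defs.
From mathcomp Require Import all_boot.

(** Let xy be an edge contained in no even cycle.  Grow an st-ordering from x
    to y, that is a list of vertices starting at x and ending at y in which
    every other vertex has an earlier and a later neighbour, together with a
    2-colouring for which these neighbours have the other colour and x, y have
    the same colour.  Given a before b in the list, descending from a to x and
    ascending from b to y yields disjoint alternating paths; hence every ear
    from a to b closes up to a cycle through xy, and as this cycle is odd the
    colouring extends along the ear.  By 2-connectedness ears exist until all
    vertices are listed, and then xy is the only monochromatic edge.  Counting
    degrees over the two colour classes gives k | 2. *)

(** * Alternating edges and st-orderings *)

Definition alternating {T : finType} (e : rel T) (c : T -> bool) : rel T :=
  [rel a b | e a b && (c a != c b)].

Lemma alternatingE {T : finType} (e : rel T) c a b :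
  alternating e c a b = e a b && (c a != c b).
Proof. by []. Qed.

(* The ordering is the list [u :: t]; [subseq [:: b; a] (u :: t)] says that b
   comes before a. *)
Definition st_order {T : finType} (e : rel T) (c : T -> bool) (u v : T)
    (t : seq T) : Prop :=
  [/\ uniq (u :: t), last u t = v, c u = c v &
   forall a, a \in t -> a != v ->
     (exists2 b, alternating e c a b & subseq [:: b; a] (u :: t)) /\
     (exists2 b, alternating e c a b & subseq [:: a; b] (u :: t))].

Definition in_even_cycle {T : finType} (e : rel T) (u v : T) : Prop :=
  exists c : seq T,
    [/\ is_cycle e c, edge_in_cycle u v c & ~~ odd (size c)].

(** * Positions in lists, alternating paths and recolouring *)

Lemma subseq2_index {T : eqType} (s : seq T) (a b : T) :
  uniq s -> subseq [:: a; b] s -> index a s < index b s.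
Proof.
elim: s => [|z s IHs] //= /andP[zNs us].
have [eq_az|_ sab] := eqVneq a z; last first.
  have bs : b \in s by apply: (mem_subseq sab); rewrite !inE eqxx orbT.
  have [eq_zb|_] := eqVneq z b; first by rewrite eq_zb bs in zNs.
  by rewrite ltnS IHs.
rewrite sub1seq => bs; have [eq_ab|//] := eqVneq z b.
by rewrite eq_ab bs in zNs.
Qed.

Lemma subseq2_total {T : eqType} (s : seq T) (a b : T) :
  a \in s -> b \in s -> a != b -> subseq [:: a; b] s || subseq [:: b; a] s.
Proof.
elim: s => [|z s IHs] //; rewrite !inE /=.
have [->|az] := eqVneq a z; have [->|bz] := eqVneq b z => //=.
  by rewrite sub1seq => _ ->.
by rewrite !sub1seq => ->; rewrite orbT.
Qed.

Lemma last_alternating {T : finType} (e : rel T) c x p :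
  path (alternating e c) x p -> c (last x p) = c x (+) odd (size p).
Proof.
elim: p x => [|z p IHp] x /=; first by rewrite addbF.
by case/andP=> /andP[_ cxz] /IHp ->; move: cxz; case: (c x) (c z) (odd _) => [] [] [].
Qed.

(** The measure [f] cannot decrease forever, and [w] is the only place where the walk may stop.
    Ascents are covered too, by taking for [f] the distance to the end of the list. *)
Lemma descending_path {T : finType} (R : rel T) (f : T -> nat) (P : pred T) w :
  (forall x, P x -> x != w -> exists2 y, P y & R x y && (f y < f x)) ->
  forall x, P x -> exists p, [/\ path R x p, last x p = w & all P p].
Proof.
move=> step x; have [n] := ubnP (f x); elim: n x => // n IHn x ltfn Px.
have [->|xw] := eqVneq x w; first by exists [::].
have [y Py /andP[Rxy ltyx]] := step x Px xw.
have [|p [Rp lp allp]] := IHn y _ Py; first exact: leq_trans ltyx ltfn.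
by exists (y :: p); split; rewrite //= ?Rxy ?Py.
Qed.

(** The edge [uv] closes the path to a cycle with [size q + 2] vertices; [q != [::]] rules out the
    degenerate cycle [[:: v; u]]. *)
Lemma in_even_cycle_path {T : finType} (e : rel T) u v q :
  e v u -> path e u (rcons q v) -> uniq (u :: rcons q v) ->
  q != [::] -> ~~ odd (size q) -> in_even_cycle e u v.
Proof.
move=> evu eq_ uq qn0 ev; exists [:: v, u & q]; split.
- apply/andP; split; first by case: q qn0 {eq_ uq ev}.
  rewrite /ucycleb; apply/andP; split; first by rewrite /= evu.
  by rewrite cons_uniq -rcons_uniq.
- rewrite /edge_in_cycle !inE !eqxx orbT /= !eqxx.
  by rewrite orbT.
- by rewrite /= negbK.
Qed.

(** Each colour on [p] is forced by the preceding vertex; as no vertex repeats, these demands never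
    conflict, and [x] keeps its colour. *)
Lemma recolor_path {T : finType} (e : rel T) (c : T -> bool) x p :
  path e x p -> uniq (x :: p) ->
  exists2 c' : T -> bool, {in [predC p], c' =1 c} & path (alternating e c') x p.
Proof.
elim: p x c => [|z p IHp] x c; first by exists c.
rewrite [path _ _ _]/= cons_uniq inE negb_or.
case/andP=> exz ep /andP[/andP[xz xp] uzp].
pose c1 w := if w == z then ~~ c x else c w.
have [c' c'E altp] := IHp z c1 ep uzp.
have zp : z \notin p by case/andP: uzp.
exists c' => [w|].
  rewrite !inE negb_or => /andP[wz wp]; rewrite c'E ?inE //.
  by rewrite /c1 (negPf wz).
rewrite [path _ _ _]/= altp andbT alternatingE exz !c'E ?inE // /c1 eqxx (negPf xz) /=.
by case: (c x).
Qed.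

Lemma path_neighbours {T : eqType} (R : rel T) x p y z :
  path R x (rcons p y) -> z \in p ->
  (exists2 b, R b z & subseq [:: b; z] (x :: p)) /\
  (exists2 b, R z b & subseq [:: z; b] (rcons p y)).
Proof.
move=> Rp zp; case/splitPr: zp Rp => p1 p2.
rewrite rcons_cat cat_path rcons_cons [path _ (last _ _) _]/=.
move=> /and3P[_ Rz Rp2]; split.
  exists (last x p1) => //; rewrite -cat_cons (lastI x p1) cat_rcons.
  apply: subseq_trans (suffix_subseq _ _).
  by rewrite /= !eqxx sub0seq.
exists (head y p2); first by case: p2 Rp2 => [|w p2] /= /andP[].
apply: subseq_trans (suffix_subseq _ _); rewrite /= eqxx sub1seq.
by case: p2 {Rp2} => [|w p2] /=; rewrite inE eqxx.
Qed.

(** * Attaching an ear to an st-ordering *)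

Section StOrder.

Variables (T : finType) (e : rel T) (u v : T).
Hypotheses (esym : symmetric e) (euv : e u v).

Lemma alternating_sym c : symmetric (alternating e c).
Proof. by move=> a b; rewrite !alternatingE esym eq_sym. Qed.

(** Descent from [x] to [u], the ear, and ascent from [y] to [v] close up with [uv]. If that cycle
    is odd, the parity of the ear is determined by the colours of its ends, because [c u = c v]. *)
Lemma st_order_ear (c : T -> bool) (t : seq T) (x y : T) (p : seq T) :
  st_order e c u v t ->
  subseq [:: x; y] (u :: t) -> path e x (rcons p y) -> uniq p ->
  ~~ has (mem (u :: t)) p ->
  [\/ in_even_cycle e u v, odd (size p) = (c x == c y)
    | [/\ p = [::], x = u & y = v]].
Proof.
move=> [ut lt cuv nb] sxy exy up pNs.
set s := u :: t in ut nb sxy pNs.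
have ltix a b : subseq [:: a; b] s -> index a s < index b s.
  exact: subseq2_index.
have iu : index u s = 0 by rewrite /s /= eqxx.
have iv : index v s = size t by rewrite -lt index_last.
have sin a b : subseq [:: a; b] s -> (a \in s) && (b \in s).
  by move/mem_subseq => sub; rewrite !sub ?inE ?eqxx ?orbT.
have sNv a b : subseq [:: a; b] s -> a != v.
  move=> sab; apply: contraTneq (ltix _ _ sab) => ->.
  by rewrite iv -leqNgt -ltnS -[(size t).+1]/(size s) index_mem; case/andP: (sin _ _ sab).
have sNu a b : subseq [:: a; b] s -> b != u.
  by move=> sab; apply: contraTneq (ltix _ _ sab) => ->; rewrite iu.
have nb' a : a \in s -> a != u -> a != v ->
  (exists2 b, alternating e c a b & subseq [:: b; a] s) /\
  (exists2 b, alternating e c a b & subseq [:: a; b] s).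
  by rewrite inE => /predU1P[->|/nb//]; rewrite eqxx.
clearbody s.
(* Monotone indices make each path simple and keep the two apart: one stays at or before [x], the
   other at or after [y]. *)
pose Rd := [rel a b | alternating e c a b && (index b s < index a s)].
pose Ra := [rel a b | alternating e c a b && (index a s < index b s)].
(* [st_order] promises no neighbours at [v], so the descent must avoid it; it does, since a vertex
   preceding another one is not last. *)
have [||d [Rdd ld sd]] :=
    @descending_path T Rd (index^~ s) [pred a | (a \in s) && (a != v)] u _ x.
- move=> a /andP[/= sa av] au; have [[b ab ba] _] := nb' _ sa au av.
  exists b; first by rewrite /= (sNv _ _ ba); case/andP: (sin _ _ ba) => ->.
  by rewrite /= ab ltix.
- by rewrite /= (sNv _ _ sxy); case/andP: (sin _ _ sxy) => ->.
have [||a [Raa la sa]] :=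
    @descending_path T Ra (fun a => size s - index a s)
      [pred a | (a \in s) && (a != u)] v _ y.
- move=> a /andP[/= sa au] av; have [_ [b ab ba]] := nb' _ sa au av.
  exists b; first by rewrite /= (sNu _ _ ba); case/andP: (sin _ _ ba) => _ ->.
  apply/andP; split; first by rewrite /= ab ltix.
  by apply: ltn_sub2l; [rewrite index_mem | apply: ltix].
- by rewrite /= (sNu _ _ sxy); case/andP: (sin _ _ sxy) => _ ->.
have [xs ys] : x \in s /\ y \in s by apply/andP/sin.
have Rdh : path (alternating e c) x d.
  by apply: sub_path Rdd => ? ? /andP[].
have Rah : path (alternating e c) y a.
  by apply: sub_path Raa => ? ? /andP[].
have Rdi : path [rel a b | index b s < index a s] x d.
  by apply: sub_path Rdd => ? ? /andP[].
have Rai : path [rel a b | index a s < index b s] y a.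
  by apply: sub_path Raa => ? ? /andP[].
have gttr : transitive [rel a b | index b s < index a s].
  by move=> ? ? ? /= h1 h2; apply: ltn_trans h2 h1.
have lttr : transitive [rel a b | index a s < index b s].
  by move=> ? ? ? /=; apply: ltn_trans.
have ud : uniq (x :: d).
  by apply: (sorted_uniq gttr) => // ?; rewrite /= ltnn.
have ua : uniq (y :: a).
  by apply: (sorted_uniq lttr) => // ?; rewrite /= ltnn.
have di z : z \in x :: d -> (z \in s) && (index z s <= index x s).
  rewrite inE => /predU1P[->|zd]; first by rewrite xs leqnn.
  have /andP[-> _] := allP sd _ zd.
  by have /allP/(_ _ zd)/ltnW := order_path_min gttr Rdi.
have ai z : z \in y :: a -> (z \in s) && (index y s <= index z s).
  rewrite inE => /predU1P[->|za]; first by rewrite ys leqnn.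
  have /andP[-> _] := allP sa _ za.
  by have /allP/(_ _ za)/ltnW := order_path_min lttr Rai.
have evu : e v u by rewrite esym.
have altE : subrel (alternating e c) e by move=> ? ? /andP[].
(* The interior of the path from [u] to [v]: [belast] drops the endpoints [u] and [v]. *)
pose q := rev (belast x d) ++ p ++ belast y a.
have LE : u :: rcons q v = rev (x :: d) ++ p ++ y :: a.
  by rewrite (lastI x) (lastI y) ld la rev_rcons /q -!cats1 -!catA.
have uL : uniq (u :: rcons q v).
  rewrite LE !cat_uniq rev_uniq ud up ua has_cat negb_or -!all_predC andbT !andTb -andbA.
  apply/and3P; split.
  - apply/allP => z zp /=; rewrite mem_rev; apply: contraNN pNs => /di/andP[zs _].
    by apply/hasP; exists z.
  - apply/allP => z /ai /andP[_ yz] /=; rewrite mem_rev.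
    apply/negP => /di /andP[_ zx].
    by move: (ltix _ _ sxy); rewrite ltnNge (leq_trans yz zx).
  - apply/allP => z /ai /andP[zs _] /=; apply: contraNN pNs => zp.
    by apply/hasP; exists z.
have eL : path e u (rcons q v).
  rewrite -[path _ _ _]/(sorted e (u :: rcons q v)) LE rev_cons cat_rcons.
  rewrite sorted_cat_cons -rev_cons rev_sorted -cat_rcons cat_path exy last_rcons.
  rewrite (sub_path altE Rah) /= andbT.
  by apply: sub_path Rdh => ? ? /altE; rewrite esym.
(* The third case of the lemma is the edge uv itself, which closes no cycle. *)
have [ev|odq] := boolP (odd (size q)); last first.
  have [q0|qn0] := eqVneq q [::]; last first.
    by constructor 1; apply: in_even_cycle_path qn0 odq.
  constructor 3; move: (congr1 size q0); rewrite /q !size_cat size_rev !size_belast.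
  move/eqP; rewrite !addn_eq0 => /and3P[/nilP d0 /nilP -> /nilP a0].
  by rewrite -ld -la d0 a0.
constructor 2; move: ev; rewrite /q !size_cat size_rev !size_belast !oddD.
move: (last_alternating _ _ _ _ Rdh) (last_alternating _ _ _ _ Rah); rewrite ld la -cuv => ->.
by case: (c x) (c y) (odd (size d)) (odd (size a)) (odd (size p)) => [] [] [] [] [].
Qed.

(** The ear is inserted right after [x], hence before [y], and recoloured alternately starting from
    [x]. *)
Lemma st_order_extend c t x y p :
  st_order e c u v t ->
  subseq [:: x; y] (u :: t) -> path e x (rcons p y) -> uniq p ->
  ~~ has (mem (u :: t)) p -> p != [::] ->
  in_even_cycle e u v \/
  exists c' t', st_order e c' u v t' /\ size t < size t'.
Proof.
move=> stt sxy exy up pNs pn0.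
have [|odp|[p0]] := st_order_ear _ _ _ _ _ stt sxy exy up pNs; first by left.
  2: by rewrite p0 in pn0.
right; have [ut lt cuv nb] := stt.
have [xs ys] : x \in u :: t /\ y \in u :: t.
  by split; apply: (mem_subseq sxy); rewrite !inE eqxx ?orbT.
have sNp w : w \in u :: t -> w \notin p.
  by move=> ws; apply: contraNN pNs => wp; apply/hasP; exists w.
have exp : path e x p by move: exy; rewrite rcons_path => /andP[].
have [|c' c'E altp] := recolor_path _ c _ _ exp; first by rewrite /= sNp.
have c's : {in u :: t, c' =1 c} by move=> w ws; apply: c'E; apply: sNp.
(* Recolouring settles every edge but the last one, into [y]; that one alternates by the parity
   [odp]. *)
have altxy : path (alternating e c') x (rcons p y).
  rewrite rcons_path altp alternatingE (last_alternating _ _ _ _ altp).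
  rewrite !c's // odp; move: exy; rewrite rcons_path => /andP[_ ->] /=.
  by case: (c x) (c y) => [] [].
have [a [b sE]] : exists a b, u :: t = a ++ x :: b.
  by case/splitPr: xs => a b; exists a, b.
have xa : x \notin a.
  by move: ut; rewrite sE cat_uniq /= negb_or => /and3P[_ /andP[]].
have yx : y != x.
  by apply: contraTneq (subseq2_index _ _ _ ut sxy) => ->; rewrite ltnn.
have yb : y \in b.
  move: (subseq2_index _ _ _ ut sxy) (ys); rewrite sE !index_cat (negPf xa).
  rewrite mem_cat /= eqxx inE (negPf yx); case: ifP => // ya.
  by rewrite addn0 ltnNge ltnW // index_mem.
have [t' s'E] : exists t', u :: t' = a ++ x :: p ++ b.
  case: (a) sE => [[-> _]|w a1 [-> _]]; first by exists (p ++ b).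
  by exists (a1 ++ x :: p ++ b).
have sub_s : subseq (u :: t) (u :: t').
  rewrite s'E sE -!cat_rcons; apply: cat_subseq => //; exact: suffix_subseq.
have sub_xp : subseq (x :: p) (u :: t').
  rewrite s'E -cat_cons; apply: subseq_trans (suffix_subseq _ _).
  exact: prefix_subseq.
have sub_py : subseq (rcons p y) (u :: t').
  rewrite s'E -cat_rcons; apply: subseq_trans (suffix_subseq _ _).
  by rewrite -cats1; apply: cat_subseq; rewrite ?sub1seq.
have us' : uniq (u :: t').
  rewrite s'E -cat_rcons uniq_catCA cat_rcons -sE cat_uniq up ut andbT andTb.
  by apply/hasPn => w; apply: sNp.
have mem_s' w : w \in u :: t' -> (w \in u :: t) || (w \in p).
  by rewrite s'E sE !(mem_cat, inE) => /or4P[] ->; rewrite ?orbT.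
exists c', t'; split; last first.
  move: (congr1 size s'E) (congr1 size sE); rewrite !size_cat /= size_cat.
  rewrite !addnS => -[->] [->]; rewrite addnCA -[X in X < _]add0n ltn_add2r.
  by rewrite lt0n size_eq0.
split=> //.
(* Since [y] lies in [b], the tail after the ear is nonempty and still ends in [v]. *)
- have: last u (u :: t') = last u (u :: t).
    by rewrite s'E sE !last_cat /= last_cat; case: (b) yb.
  by rewrite /= lt.
- by rewrite !c's // -?lt ?mem_last // inE eqxx.
move=> w wt' wv.
have wu : w != u.
  by apply: contraTneq us' => <-; rewrite /= wt'.
have /orP[ws|wp] : (w \in u :: t) || (w \in p) by apply: mem_s'; rewrite inE wt' orbT.
  (* An old vertex keeps its two neighbours: old colours and the old relative order are
     unchanged. *)
  move: (ws); rewrite inE (negPf wu) => /= wt.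
  have alts z : z \in u :: t -> alternating e c' w z = alternating e c w z.
    by move=> zs; rewrite !alternatingE !c's.
  have [[z1 wz1 sub1] [z2 wz2 sub2]] := nb w wt wv; split.
    exists z1; last exact: subseq_trans sub1 sub_s.
    by rewrite alts //; apply: (mem_subseq sub1); rewrite !inE eqxx.
  exists z2; last exact: subseq_trans sub2 sub_s.
  by rewrite alts //; apply: (mem_subseq sub2); rewrite !inE eqxx orbT.
(* A new vertex uses its predecessor and successor along the ear. *)
have [[z1 wz1 sub1] [z2 wz2 sub2]] := path_neighbours _ _ _ _ _ altxy wp.
split; first by exists z1; [rewrite alternating_sym | apply: subseq_trans sub1 sub_xp].
by exists z2; last exact: subseq_trans sub2 sub_py.
Qed.

(** * Ears from 2-connectedness, and a spanning st-ordering *)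

Lemma connect_first_hit (R : rel T) (S : pred T) z w :
  connect R z w -> ~~ S z -> S w ->
  exists p y,
    [/\ path R z (rcons p y), uniq (z :: p), ~~ has S (z :: p) & S y].
Proof.
move=> /connectP[q0 /shortenP[q Rq uq _] ->] Sz Sl.
have hS : has S q.
  case: q Sl {Rq uq} => [Sz'|a q Sl]; first by rewrite Sz' in Sz.
  by apply/hasP; exists (last a q); rewrite ?mem_last.
case: (split_find hS) Rq uq => y p q1 Sy Sp; rewrite cat_path => /andP[Rp _].
rewrite -cat_cons cat_uniq => /andP[]; rewrite -rcons_cons rcons_uniq.
by move=> /andP[_ up] _; exists p, y; rewrite /= negb_or Sz Sp.
Qed.

(** A path from [z] first enters [S] at some [x], coming from [z1] outside [S]. Deleting [x] leaves
    the graph connected, so [z1] also reaches [S] at a vertex other than [x]. *)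
Lemma ear_exists (S : pred T) z :
  irreflexive e -> k_connected 2 e -> S u -> S v -> ~~ S z ->
  exists x y p,
    [/\ S x, S y & x != y] /\
    [/\ path e x (rcons p y), uniq p, ~~ has S p & p != [::]].
Proof.
move=> eirr [_ conn] Su Sv Sz.
have sub_e A : subrel (induced e A) e by move=> ? ? /and3P[].
have [_ conn0] : connected_on e (~: set0) by apply: conn; rewrite cards0.
have [||p0 [x [ep0 _ Sp0 Sx]]] := connect_first_hit _ S z u (conn0 z u _ _) Sz Su.
  1,2: by rewrite !inE.
pose z1 := last z p0.
have Sz1 : ~~ S z1 by apply: (hasPn Sp0); apply: mem_last.
have exz1 : e x z1.
  by rewrite esym; move: ep0; rewrite rcons_path => /andP[_ /sub_e].
have [w Sw wx] : exists2 w, S w & w != x.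
  have [<-|ux] := eqVneq u x; last by exists u.
  by exists v => //; apply: contraTneq euv => ->; rewrite eirr.
have z1x : z1 != x by apply: contraNneq Sz1 => ->.
have [_ conn1] : connected_on e (~: [set x]) by apply: conn; rewrite cards1.
have [||p [y [ep up Sp Sy]]] := connect_first_hit _ S z1 w (conn1 z1 w _ _) Sz1 Sw.
  1,2: by rewrite !inE.
exists x, y, (z1 :: p); split; split=> //.
  by move: ep; rewrite rcons_path => /andP[_ /and3P[_]]; rewrite !inE eq_sym.
by rewrite /= exz1; apply: sub_path ep.
Qed.

Lemma st_order_spanning :
  irreflexive e -> k_connected 2 e ->
  in_even_cycle e u v \/
  exists c t, st_order e c u v t /\ forall x, x \in u :: t.
Proof.
move=> eirr conn.
have uv : u != v by apply: contraTneq euv => ->; rewrite eirr.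
(* Each ear lengthens the list; for [n = #|T|] the alternative [n < size t] contradicts the absence
   of repetitions. *)
suff ext n : in_even_cycle e u v \/
    exists c t, st_order e c u v t /\ (n < size t \/ forall x, x \in u :: t).
  case: (ext #|T|) => [|[c [t [st [lt|]]]]]; [by left| |by right; exists c, t].
  have [ut _ _ _] := st; move: (max_card (mem (u :: t))).
  by rewrite (card_uniqP ut) leqNgt /= ltnW.
elim: n => [|n [|[c [t [st [lt|all_t]]]]]]; [right| by left | |]; last first.
- by right; exists c, t; split=> //; right.
- have [/forallP all_t|/forallPn/=[z zs]] := boolP [forall x, x \in u :: t].
    by right; exists c, t; split=> //; right.
  have [_ lt_v _ _] := st.
  have [||x [y [p [[xs ys xy] [exy up ps pn0]]]]] :=
    ear_exists (mem (u :: t)) z eirr conn _ _ zs.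
  - by rewrite /= inE eqxx.
  - by rewrite /= -lt_v mem_last.
  have [|[c' [t' [st' lt']]]] : in_even_cycle e u v \/
      exists c' t', st_order e c' u v t' /\ size t < size t'.
    (* If [y] comes before [x], the ear is traversed backwards. *)
    have /orP[sxy|syx] := subseq2_total _ _ _ xs ys xy.
      exact: st_order_extend st sxy exy up ps pn0.
    apply: (st_order_extend _ _ _ _ (rev p) st syx).
    + have := rev_path e x (rcons p y).
      rewrite last_rcons belast_rcons rev_cons => ->.
      by apply: sub_path exy => ? ?; rewrite esym.
    + by rewrite rev_uniq.
    + by rewrite has_rev.
    + by rewrite -size_eq0 size_rev size_eq0.
  + by left.
  by right; exists c', t'; split=> //; left; apply: leq_trans lt'.
(* The initial list is [u], [v] in one colour, with no inner vertex to check. *)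
- exists (fun=> true), [:: v]; split; last by left.
  split=> //=; first by rewrite inE uv.
  by move=> a; rewrite inE => /eqP->; rewrite eqxx.
Qed.

(** * Monochromatic edges and the degree count *)

Lemma monochromatic_edge c t :
  st_order e c u v t -> (forall x, x \in u :: t) -> irreflexive e ->
  in_even_cycle e u v \/
  forall a b, c a = c b ->
    e a b = ((a, b) \in [set (u, v); (v, u)]).
Proof.
move=> st all_t eirr; have [ut lt cuv _] := st.
have mono a b : subseq [:: a; b] (u :: t) -> e a b -> c a = c b ->
    in_even_cycle e u v \/ a = u /\ b = v.
  move=> sab eab cab.
  (* An edge is an ear without inner vertices; its length parity would force different colours at
     its ends, unless it is [uv] itself. *)
  have eab' : path e a (rcons [::] b) by rewrite /= eab.
  have [|/=|[_ -> ->]] := st_order_ear _ _ _ _ [::] st sab eab' isT isT.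
  - by left.
  - by rewrite cab eqxx.
  - by right.
pose D := [set (u, v); (v, u)].
have [ok|] := boolP [forall a, forall b, (c a == c b) ==> (e a b == ((a, b) \in D))].
  by right=> a b /eqP cab; apply/eqP; move/'forall_'forall_implyP: ok; apply.
move=> /forallPn[a /forallPn[b]]; rewrite negb_imply => /andP[/eqP cab].
have eD : (a, b) \in D -> e a b.
  by rewrite !inE => /orP[] /eqP[-> ->]; rewrite // esym.
move=> ne; left; have {ne}[eab abD] : e a b /\ (a, b) \notin D.
  by move: ne eD; case: (e a b); case: (_ \in D) => //= _ /(_ isT).
move: abD; rewrite !inE !xpair_eqE negb_or => /andP[ab1 ab2].
have ab : a != b by apply: contraTneq eab => ->; rewrite eirr.
have /orP[sab|sba] := subseq2_total _ _ _ (all_t a) (all_t b) ab.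
  have [//|[au bv]] := mono _ _ sab eab cab.
  by rewrite au bv !eqxx in ab1.
have eba : e b a by rewrite esym.
have [//|[bu av]] := mono _ _ sba eba (Logic.eq_sym cab).
by rewrite av bu !eqxx in ab2.
Qed.

(** Edges between the classes contribute equally to both sums. The only other edge, [uv], lies in
    the class of [u] and is counted once from each end. *)
Lemma degree_sum_classes (c : pred T) :
  c u -> c v -> u != v ->
  (forall a b, c a = c b -> e a b = ((a, b) \in [set (u, v); (v, u)])) ->
  \sum_(a | c a) degree e a = \sum_(a | ~~ c a) degree e a + 2.
Proof.
move=> cu cv uv mono.
have degE a : degree e a = \sum_b e a b.
  by rewrite /degree -sum1dep_card big_mkcond; apply: eq_bigr => b _; case: (e a b).
have deg_sum (P : pred T) :
    \sum_(a | P a) degree e a =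
    \sum_(a | P a) \sum_(b | ~~ c b) e a b + \sum_(a | P a) \sum_(b | c b) e a b.
  by rewrite -big_split; apply: eq_bigr => a _; rewrite degE (bigID c) /= addnC.
rewrite !deg_sum [X in _ = X + _ + _]big1 => [|a ca]; last first.
  apply: big1 => b cb; rewrite mono ?(negPf ca) ?(negPf cb) // !inE !xpair_eqE.
  have [au|_] := eqVneq a u; first by rewrite au cu in ca.
  by have [av|//] := eqVneq a v; first by rewrite av cv in ca.
rewrite add0n; congr (_ + _).
  by rewrite exchange_big; do 2![apply: eq_bigr => ? _]; rewrite esym.
(* The remaining double sum counts ordered pairs, so the 2 is the number of orientations of [uv]. *)
rewrite pair_big /= (_ : 2 = #|[set (u, v); (v, u)]|); last first.
  by rewrite cards2 xpair_eqE negb_and uv.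
rewrite -sum1_card [in RHS]big_mkcond [in LHS]big_mkcond /=.
apply: eq_bigr => -[a b] _ /=; have [/andP[ca cb]|nab] := ifP.
  by rewrite mono ?ca ?cb //; case: (_ \in _).
case: ifP => // abD; move: nab abD; rewrite !inE !xpair_eqE.
by move=> nab /orP[] /andP[/eqP au /eqP bv]; rewrite au bv cu cv in nab.
Qed.

End StOrder.

Theorem theorem3 (T : finType) (e : rel T) (k : nat) :
  simple_graph e ->
  k_connected 2 e ->
  3 <= k ->
  (forall x : T, k %| degree e x) ->
  forall x y : T, e x y ->
    exists c : seq T,
      [/\ is_cycle e c, edge_in_cycle x y c & ~~ odd (size c)].
Proof.
move=> [esym eirr] conn k3 kdeg x y exy.
have xy : x != y by apply: contraTneq exy => ->; rewrite eirr.
have [//|[c [t [st all_t]]]] := st_order_spanning _ e x y esym exy eirr conn.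
have [//|mono] := monochromatic_edge _ _ _ _ esym exy _ _ st all_t eirr.
have [_ _ cxy _] := st.
(* Comparing with [c x] selects the class of [x] and [y], whichever colour it has. *)
have deg_eq := degree_sum_classes _ e x y esym [pred a | c a == c x].
have {deg_eq} : \sum_(a | c a == c x) degree e a =
    \sum_(a | c a != c x) degree e a + 2.
  apply: deg_eq => //=; rewrite ?eqxx ?cxy //.
  by move=> a b cab; apply: mono; move: cab; case: (c a) (c b) (c y) => [] [] [].
(* Both degree sums are multiples of [k], so [k] divides their difference 2, against [3 <= k]. *)
move/(congr1 (dvdn k)); rewrite dvdn_sum // dvdn_addr ?dvdn_sum //.
by move=> dvd_k2; have := @dvdn_leq k 2 isT (Logic.eq_sym dvd_k2); rewrite leqNgt k3.
Qed.
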